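(* Let $\mathbf{X}$ be a Borel measurable space, $P$ a Markov transition kernel on $\mathbf{X}$ having a unique invariant probability measure $\Pi$, and $V : \mathbf{X} \to [0,\infty)$ a Borel measurable function. Assume: 1. There exists a constant $K \in (0,\infty)$ such that $P V(x) \le K$ for all $x \in \mathbf{X}$. 2. There exist a constant $r > 1$, a probability measure $\nu$ on $\mathbf{X}$ and a constant $\alpha_r \in (0,1]$ such that $$\inf_{\{x \in \mathbf{X} : V(x) \le rK\}} P(x,\cdot) \ge \alpha_r\, \nu(\cdot),$$ i.e. $P(x,B) \ge \alpha_r \nu(B)$ for every Borel set $B\subseteq\mathbf{X}$ and every $x$ with $V(x) \le rK$. Let $c : [0,\infty) \to [0,\infty)$ be any nondecreasing concave function. Then for all $x \in \mathbf{X}$ and all integers $t \ge 1$, $$\left\| P^{2t}(x,\cdot) - \Pi(\cdot) \right\|_{\mathrm{TV}} \le \big(1 - \alpha_r(1-1/r)\big)^t,$$ $$\left\| P^{2t+1}(x,\cdot) - \Pi(\cdot) \right\|_{c(V)} \le 2\,c(K)\,\big(1 - \alpha_r(1-1/r)\big)^t.$$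
   Context: For a Borel function $f$, $Pf(x) = \int_{\mathbf{X}} f(y)\,P(x,dy)$; $P^t$ denotes the $t$-step kernel ($P^1=P$, $P^{t+1}f = P P^t f$). A probability measure $\Pi$ is invariant if $\Pi P = \Pi$, where $\Pi P(\cdot) = \int P(y,\cdot)\,\Pi(dy)$. Total variation is normalized as $\|P^t(x,\cdot)-\Pi\|_{\mathrm{TV}} = \sup_{f:\mathbf{X}\to[0,1]} \left|P^t f(x) - \int f\,d\Pi\right|$ (supremum over Borel $f$). For a Borel function $W:\mathbf{X}\to[0,\infty)$, $\|P^t(x,\cdot)-\Pi\|_{W} = \sup_{|f|\le W} \left|P^t f(x) - \int f\,d\Pi\right|$, the supremum being over Borel functions $f:\mathbf{X}\to\mathbb{R}$ with $|f|\le W$. Here $c(V)$ denotes the function $x\mapsto c(V(x))$. *)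

(* Defs.v *)
From HB Require Import structures.
From mathcomp Require Import all_boot all_order all_algebra.
From mathcomp Require Import all_classical all_reals all_analysis.
From mathcomp Require Import measurable_realfun lra.

Set Implicit Arguments.
Unset Strict Implicit.
Unset Printing Implicit Defensive.
Import Order.TTheory GRing.Theory Num.Theory.
Import numFieldNormedType.Exports.
Local Open Scope classical_set_scope.
Local Open Scope ring_scope.
Local Open Scope ereal_scope.

(* The library only knows that the composition of two probability kernels is a
   subprobability kernel. *)
Section probability_kcomp_noparam.
Context d0 d1 d2 (T0 : measurableType d0) (T1 : measurableType d1)
  (T2 : measurableType d2) {R : realType}
  (k1 : R.-pker T0 ~> T1) (k2 : R.-pker T1 ~> T2).

Let prob_kernel x : mkcomp_noparam k1 k2 x [set: T2] = 1.
Proof.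
rewrite /mkcomp_noparam /= /kcomp_noparam.
under eq_integral do rewrite prob_kernel.
by rewrite integral_cst//= mul1e prob_kernel.
Qed.

HB.instance Definition _ :=
  isProbabilityKernel.Build _ _ _ _ R (mkcomp_noparam k1 k2) prob_kernel.

End probability_kcomp_noparam.

Section markov.
Context d (X : measurableType d) (R : realType).

(* kpow P t x is the law P^t(x, .), with P^0(x, .) the Dirac mass at x and
   P^(t+1)(x, A) = \int P^t(y, A) P(x, dy). *)
Fixpoint kpow (P : R.-pker X ~> X) (t : nat) : R.-pker X ~> X :=
  if t is t'.+1 then mkcomp_noparam P (kpow P t')
  else kdirac (@measurable_id _ X [set: X]).

(* Measures are total functions on sets, of which only the values on
   measurable sets are meaningful: equality of measures is stated there. *)
Definition invariant (P : R.-pker X ~> X) (Pi : probability X R) : Prop :=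
  forall A, measurable A -> \int[Pi]_y P y A = Pi A.

Definition unique_invariant (P : R.-pker X ~> X) (Pi : probability X R) :=
  invariant P Pi /\
  forall Pi' : probability X R, invariant P Pi' ->
    forall A, measurable A -> Pi' A = Pi A.

(* With values of f in [0, 1], the diameter is 1 (not 2). *)
Definition tv_dist (mu nu : {measure set X -> \bar R}) : \bar R :=
  ereal_sup [set `|\int[mu]_y (f y)%:E - \int[nu]_y (f y)%:E| |
    f in [set f : X -> R | measurable_fun [set: X] f /\
                           forall y, (0 <= f y <= 1)%R]].

Definition weighted_dist (W : X -> R) (mu nu : {measure set X -> \bar R}) :
    \bar R :=
  ereal_sup [set `|\int[mu]_y (f y)%:E - \int[nu]_y (f y)%:E| |
    f in [set f : X -> R | measurable_fun [set: X] f /\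
                           forall y, (`|f y| <= W y)%R]].

Lemma kpow1 (P : R.-pker X ~> X) x A : measurable A -> kpow P 1 x A = P x A.
Proof.
move=> mA; rewrite /= /kcomp_noparam.
transitivity (\int[P x]_y (\1_A y)%:E); first exact: eq_integral.
by rewrite integral_indic// setIT.
Qed.

(* P^(t+1) f = P (P^t f) *)
Lemma integral_kpowS (P : R.-pker X ~> X) (t : nat) (x : X) (f : X -> \bar R) :
  (forall y, 0 <= f y) -> measurable_fun [set: X] f ->
  \int[kpow P t.+1 x]_z f z = \int[P x]_y \int[kpow P t y]_z f z.
Proof.
move=> f0 mf.
exact: (@integral_kcomp _ _ _ _ _ _ _ P (kernel.kernel_snd (kpow P t)) x f).
Qed.

End markov.

Definition concave_function (R : realType) (D : set R) (f : R -> R) : Prop :=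
  convex_function D (fun u => (- f u)%R).

Lemma concave_functionP (R : realType) (D : set R) (f : R -> R) :
  concave_function D f <->
  forall l, (0 <= l <= 1)%R -> forall x y, D x -> D y ->
    (l * f x + (1 - l) * f y <= f (l * x + (1 - l) * y))%R.
Proof.
split=> [h l /andP[l0 l1] x y Dx Dy|h l x y].
  have := h (Itv01 l0 l1) x y; rewrite !inE => /(_ Dx Dy).
  by rewrite !convRE /= /unstable.onem; lra.
rewrite !inE => Dx Dy.
have l01 : (0 <= l%:num <= 1)%R by rewrite ge0 le1.
have := h _ l01 x y Dx Dy.
by rewrite !convRE /= /unstable.onem; lra.
Qed.

(* Main.v *)
Require Import Defs.
From HB Require Import structures.
From mathcomp Require Import all_boot all_order all_algebra.
From mathcomp Require Import all_classical all_reals all_analysis.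
From mathcomp Require Import measurable_realfun ring lra.

Set Implicit Arguments.
Unset Strict Implicit.
Unset Printing Implicit Defensive.
Import Order.TTheory GRing.Theory Num.Theory.
Import numFieldNormedType.Exports.
Local Open Scope classical_set_scope.
Local Open Scope ring_scope.

(** Two steps of the chain satisfy a Doeblin condition on the whole space.
From any point the first step lands in the set V <= r K with probability at
least 1 - 1/r, because P V <= K and by Markov's inequality; from there the
second step dominates alpha nu.  Hence P^2(x, .) >= b nu for every x, with
b = alpha (1 - 1/r) (minorization_kpow2).

Such a minorization shrinks the oscillation of a bounded function g by the
factor 1 - b at each application of P^2 (doeblin_contraction): if g takes its
values in [m, m + D], the inequality can be applied to both nonnegative
functions g - m and m + D - g, and confines P^2 g to an interval of length
(1 - b) D.  If P^s f has values in [0, M], it follows that P^(2t+s) f varies by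
at most M (1 - b)^t; its Pi-average is the integral of f against Pi, by
invariance, so that each of its values is within M (1 - b)^t of that integral
(doeblin_convergence).

The total variation bound is the case s = 0, M = 1.  For the weighted bound,
Jensen's inequality gives P (c(V)) <= c(P V) <= c(K)
(le_integral_concave), so that s = 1 and M = c(K) fit both the positive and the
negative part of any f with |f| <= c(V).  The factor 2 comes from adding the
two estimates.  As the two parts are nonnegative, iterated integrals are handled
by Tonelli's theorem, and the finiteness of the integrals of f is part of the
conclusion. *)

(** * Integrals against iterated kernels *)

Section kernel_integrals.
Local Open Scope ereal_scope.
Context d (X : measurableType d) (R : realType).
Implicit Types (P : R.-pker X ~> X) (f : X -> \bar R).

Lemma measurable_integral_pker P f :
  (forall y, 0 <= f y) -> measurable_fun [set: X] f ->
  measurable_fun [set: X] (fun x => \int[P x]_y f y).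
Proof.
move=> f0 mf; apply: measurable_fun_integral_kernel => // U.
exact: measurable_kernel.
Qed.

Lemma integral_kpow0 P x f : measurable_fun [set: X] f ->
  \int[kpow P 0 x]_y f y = f x.
Proof.
move=> mf; rewrite [LHS](@integral_dirac _ _ x _ _ measurableT)//.
by rewrite diracT mul1e.
Qed.

Lemma integral_kpow1 P x f : \int[kpow P 1 x]_y f y = \int[P x]_y f y.
Proof. by apply: eq_measure_integral => A mA _; exact: kpow1. Qed.

(** The Chapman-Kolmogorov equations.  They allow two steps at once to be
    split off from the left. *)
Lemma integral_kpowD P s t x f :
  (forall y, 0 <= f y) -> measurable_fun [set: X] f ->
  \int[kpow P (s + t) x]_z f z = \int[kpow P s x]_y \int[kpow P t y]_z f z.
Proof.
move=> f0 mf; elim: s x => [|s IH] x.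
  by rewrite integral_kpow0//; exact: measurable_integral_pker.
rewrite addSn !integral_kpowS//.
- by apply: eq_integral => y _; exact: IH.
- by move=> y; exact: integral_ge0.
- exact: measurable_integral_pker.
Qed.

Lemma ge0_integral_invariant P (Pi : probability X R) f :
  Defs.invariant P Pi ->
  (forall y, 0 <= f y) -> measurable_fun [set: X] f ->
  \int[Pi]_y \int[P y]_z f z = \int[Pi]_z f z.
Proof.
move=> invPi f0 mf.
(* The one-point state space turns Pi into a kernel, so that Pi P is a
   composition of kernels. *)
pose k : R.-pker unit ~> X :=
  kprobability (@measurable_cst _ _ unit (pprobability X R) setT Pi).
rewrite -[LHS](@integral_kcomp _ _ _ _ _ _ _ k (kernel.kernel_snd P) tt f)//.
by apply: eq_measure_integral => A mA _; exact: invPi.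
Qed.

Lemma ge0_integral_invariant_kpow P (Pi : probability X R) t f :
  Defs.invariant P Pi ->
  (forall y, 0 <= f y) -> measurable_fun [set: X] f ->
  \int[Pi]_y \int[kpow P t y]_z f z = \int[Pi]_z f z.
Proof.
move=> invPi f0 mf; elim: t => [|t IH].
  by apply: eq_integral => y _; exact: integral_kpow0.
rewrite -IH -[RHS](ge0_integral_invariant invPi)//.
- by apply: eq_integral => y _; rewrite integral_kpowS.
- by move=> y; exact: integral_ge0.
- exact: measurable_integral_pker.
Qed.

(** * The Doeblin condition and contraction of oscillations *)

Lemma le_minorized_integral (mu nu : {measure set X -> \bar R}) (b : R) f :
  (0 <= b)%R -> (forall B, measurable B -> b%:E * nu B <= mu B) ->
  (forall y, 0 <= f y) -> measurable_fun [set: X] f ->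
  b%:E * \int[nu]_y f y <= \int[mu]_y f y.
Proof.
move=> b0 numu f0 mf.
rewrite -(@ge0_integral_mscale _ _ _ nu _ measurableT (NngNum b0))//.
exact: ge0_le_measure_integral.
Qed.

Lemma integrable_between (mu : {measure set X -> \bar R}) (h : X -> R)
    (u v : R) :
  mu [set: X] = 1 -> measurable_fun [set: X] h ->
  (forall y, u <= h y <= v)%R -> mu.-integrable [set: X] (EFin \o h).
Proof.
move=> mu1 mh huv; apply: measurable_bounded_integrable => //.
  by rewrite mu1 ltry.
exists (`|u| + `|v|)%R; split; first exact: num_real.
move=> M ltM y _ /=; rewrite (le_trans _ (ltW ltM))// ler_norml.
have /andP[ul lv] := huv y.
have := ler_norm v; have := ler_norm (- u)%R; rewrite normrN => *.
have := normr_ge0 u; have := normr_ge0 v => *.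
by apply/andP; split; lra.
Qed.

(** Minorization bounds the integral of g - m against Q x from below by b times
    its integral against nu, which is a lower bound for Q g that does not depend
    on x; applied to m + D - g it gives an upper bound of the same kind, and the
    two differ by (1 - b) D.  The oscillation is expressed by an enclosing
    interval, a form that iterates without suprema. *)
Lemma doeblin_contraction (Q : R.-pker X ~> X) (nu : probability X R)
    (b : R) (g : X -> R) (m D : R) :
  (0 <= b)%R ->
  (forall x B, measurable B -> b%:E * nu B <= Q x B) ->
  measurable_fun [set: X] g -> (forall x, m <= g x <= m + D)%R ->
  exists m', forall x,
    m'%:E <= \int[Q x]_y (g y)%:E <= (m' + (1 - b) * D)%:E.
Proof.
move=> b0 minor mg gb.
have ig (mu : {measure set X -> \bar R}) : mu setT = 1 ->
    mu.-integrable setT (EFin \o g).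
  by move=> mu1; apply: integrable_between gb.
have ic (mu : {measure set X -> \bar R}) (a : R) : mu setT = 1 ->
    mu.-integrable setT (EFin \o fun=> a).
  by move=> mu1; apply: (@integrable_between _ _ a a) => // y; rewrite lexx.
pose E (mu : {measure set X -> \bar R}) := (\int[mu]_y g y)%R.
have Ec (mu : {measure set X -> \bar R}) a :
    mu setT = 1 -> (\int[mu]_y a)%R = a.
  by move=> mu1; rewrite Rintegral_cst// mu1 /= mulr1.
have nu1 : nu setT = 1 := probability_setT nu.
have Q1 x : Q x setT = 1 by exact: prob_kernel.
have le_E x (h : X -> R) : measurable_fun setT h ->
    (forall y, 0 <= h y <= D)%R ->
    (b * \int[nu]_y h y <= \int[Q x]_y h y)%R.
  move=> mh hD; have i1 := integrable_between nu1 mh hD.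
  have i2 := integrable_between (Q1 x) mh hD.
  rewrite -lee_fin EFinM !fineK ?integrable_fin_num//.
  apply: le_minorized_integral => //; first exact: minor.
    by move=> y; rewrite lee_fin; case/andP: (hD y).
  exact/measurable_EFinP.
(* m' is the lower bound obtained from the minorization of g - m. *)
exists (m + b * (E nu - m))%R => x.
have : (b * \int[nu]_y (m + D - g y) <= \int[Q x]_y (m + D - g y))%R.
  apply: le_E; first exact: measurable_funB.
  by move=> y; have := gb y; lra.
have : (b * \int[nu]_y (g y - m) <= \int[Q x]_y (g y - m))%R.
  apply: le_E; first exact: measurable_funB.
  by move=> y; have := gb y; lra.
rewrite !RintegralB ?ic ?ig// !Ec// -/(E nu) -/(E (Q x)) => le1 le2.
rewrite -[X in _ <= X <= _]fineK; last first.
  by apply: integrable_fin_num => //; exact: ig.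
rewrite -/(Rintegral _ _ _) -/(E (Q x)) !lee_fin.
by apply/andP; split; lra.
Qed.

(** Markov's inequality enters through the linear bound
    1_{V <= r K} >= 1 - V / (r K), which turns the local minorization into one
    that holds at every point, P y B >= alpha nu B (1 - V y / (r K)).  Its
    integral against P x involves V only through P V <= K. *)
Lemma minorization_kpow2 P (V : X -> R) (K r alpha : R) (nu : probability X R) :
  measurable_fun [set: X] V -> (forall x, 0 <= V x)%R ->
  (0 < K)%R -> (forall x, \int[P x]_y (V y)%:E <= K%:E) ->
  (1 < r)%R -> (0 <= alpha)%R ->
  (forall x, (V x <= r * K)%R ->
     forall B, measurable B -> alpha%:E * nu B <= P x B) ->
  forall x B, measurable B ->
    (alpha * (1 - 1 / r))%:E * nu B <= kpow P 2 x B.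
Proof.
move=> mV V0 K0 hK r1 a0 minor x B mB.
have rK0 : (0 < r * K)%R by rewrite mulr_gt0// (lt_trans _ r1).
have [q q0 qE] : exists2 q : R, (0 <= q)%R & nu B = q%:E.
  exists (fine (nu B)); first exact: fine_ge0.
  by rewrite fineK// fin_num_measure.
pose w := (alpha * q / (r * K))%R.
have w0 : (0 <= w)%R by apply: divr_ge0; [exact: mulr_ge0|exact: ltW].
(* Where V y > r K the bound holds because w V y alone exceeds alpha q. *)
have key y : (alpha * q)%:E <= P y B + w%:E * (V y)%:E.
  have [Vy|Vy] := leP (V y) (r * K)%R.
    apply: (@le_trans _ _ (P y B)); first by rewrite EFinM -qE minor.
    by rewrite leeDl// -EFinM lee_fin mulr_ge0.
  apply: (@le_trans _ _ (w%:E * (V y)%:E)); last by rewrite leeDr.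
  rewrite -EFinM lee_fin /w mulrAC ler_pdivlMr//.
  by rewrite ler_wpM2l ?mulr_ge0// ltW.
have : (alpha * q)%:E <= kpow P 2 x B + (alpha * q / r)%:E.
  have -> : kpow P 2 x B = \int[P x]_y P y B.
    rewrite [LHS]/=/kcomp_noparam; apply: eq_integral => y _.
    exact: (kpow1 P y mB).
  have mPB := measurable_kernel P B mB.
  have mwV : measurable_fun setT (fun y => w%:E * (V y)%:E).
    by apply/measurable_EFinP; exact: measurable_funM.
  apply: (@le_trans _ _ (\int[P x]_y (alpha * q)%:E)).
    by rewrite integral_cst// prob_kernel mule1.
  apply: (@le_trans _ _ (\int[P x]_y (P y B + w%:E * (V y)%:E))).
    apply: ge0_le_integral => //.
    - by move=> y _; rewrite lee_fin mulr_ge0.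
    - exact: emeasurable_funD.
  rewrite ge0_integralD//; last by move=> y _; rewrite -EFinM lee_fin mulr_ge0.
  rewrite leeD2l// ge0_integralZl_EFin//; last 2 first.
  - by move=> y _; rewrite lee_fin.
  - exact/measurable_EFinP.
  apply: (le_trans (lee_wpmul2l _ (hK x))); first by rewrite lee_fin.
  rewrite -EFinM lee_fin /w invfM.
  by rewrite !mulrA -[leLHS]mulrA mulVf ?mulr1// gt_eqF.
rewrite qE -EFinM -leeBlDr// -EFinB; apply: le_trans.
by rewrite lee_fin div1r; lra.
Qed.

Lemma between_fin_num (l u : R) (z : \bar R) :
  l%:E <= z <= u%:E -> z \is a fin_num.
Proof. by case: z => [r| |]//=; rewrite ?leye_eq ?leeNy_eq ?andbF. Qed.

(** The extra s steps are there to make f bounded: f itself may be unbounded,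
    as long as its image under P^s is not. *)
Lemma doeblin_iterate P (nu : probability X R) (b : R) (s : nat) (M : R)
    (f : X -> \bar R) :
  (0 <= b)%R ->
  (forall x B, measurable B -> b%:E * nu B <= kpow P 2 x B) ->
  (forall y, 0 <= f y) -> measurable_fun [set: X] f ->
  (forall x, \int[kpow P s x]_y f y <= M%:E) ->
  forall t, exists m, forall x,
    m%:E <= \int[kpow P (2 * t + s) x]_y f y <= (m + M * (1 - b) ^+ t)%:E.
Proof.
move=> b0 minor f0 mf fM; elim=> [|t [m IH]].
  by exists 0%R => x; rewrite muln0 add0n expr0 mulr1 add0r fM integral_ge0.
pose h x := \int[kpow P (2 * t + s) x]_y f y.
have hfin x : h x \is a fin_num.
  exact: between_fin_num (IH x).
pose g x := fine (h x).
have gE x : (g x)%:E = h x by rewrite fineK.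
have mh : measurable_fun [set: X] h by exact: measurable_integral_pker.
have mg : measurable_fun [set: X] g by apply: measurableT_comp.
have gb x : (m <= g x <= m + M * (1 - b) ^+ t)%R.
  by rewrite -!lee_fin gE; exact: IH.
have [m' Hm'] := doeblin_contraction b0 minor mg gb.
exists m' => x; rewrite mulnS -addnA integral_kpowD//.
rewrite exprS mulrCA; have := Hm' x.
by under eq_integral do rewrite gE.
Qed.

(** By invariance the integral of f against Pi is the Pi-average of
    x |-> P^(2t+s) f(x), hence lies in any interval containing all the values of
    that function.  The finite values u and v are exhibited so that results for
    two functions can be subtracted without indeterminate forms. *)
Lemma doeblin_convergence P (Pi nu : probability X R) (b : R) (s : nat) (M : R)
    (f : X -> \bar R) :
  Defs.invariant P Pi -> (0 <= b)%R ->
  (forall x B, measurable B -> b%:E * nu B <= kpow P 2 x B) ->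
  (forall y, 0 <= f y) -> measurable_fun [set: X] f ->
  (forall x, \int[kpow P s x]_y f y <= M%:E) ->
  forall t x, exists u v : R, [/\ \int[kpow P (2 * t + s) x]_y f y = u%:E,
    \int[Pi]_y f y = v%:E & (`|u - v| <= M * (1 - b) ^+ t)%R].
Proof.
move=> invPi b0 minor f0 mf fM t x.
(* The lower end of the interval may be raised to 0, since f >= 0; both ends are
   then integrals of nonnegative constants. *)
have [m m0 Hm] : exists2 m, (0 <= m)%R & forall x,
    m%:E <= \int[kpow P (2 * t + s) x]_y f y <= (m + M * (1 - b) ^+ t)%:E.
  have [m Hm] := doeblin_iterate b0 minor f0 mf fM t.
  exists (Num.max m 0%R) => [|y]; first by rewrite le_max lexx orbT.
  have /andP[lo hi] := Hm y.
  have h0 : 0 <= \int[kpow P (2 * t + s) y]_z f z by exact: integral_ge0.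
  apply/andP; split; first by case: (leP m 0%R).
  by rewrite (le_trans hi)// lee_fin lerD2r le_max lexx.
set D := (M * (1 - b) ^+ t)%R in Hm *.
have mh : measurable_fun [set: X] (fun x => \int[kpow P (2 * t + s) x]_y f y).
  exact: measurable_integral_pker.
have Pi1 : Pi [set: X] = 1 by exact: probability_setT.
have mean_cst (a : R) : \int[Pi]_y a%:E = a%:E.
  by rewrite integral_cst// -[RHS]mule1; congr (_ * _); exact: Pi1.
have mD0 : (0 <= m + D)%R.
  have /andP[lo hi] := Hm x.
  by rewrite -lee_fin (le_trans _ hi)// (le_trans _ lo).
have Pim : m%:E <= \int[Pi]_y f y <= (m + D)%:E.
  rewrite -(ge0_integral_invariant_kpow (2 * t + s) invPi f0 mf).
  rewrite -[in X in X <= _ <= _](mean_cst m).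
  rewrite -[in X in _ <= _ <= X](mean_cst (m + D)%R).
  apply/andP; split; apply: ge0_le_integral => //.
  - by move=> y _; case/andP: (Hm y).
  - by move=> y _; exact: integral_ge0.
  - by move=> y _; case/andP: (Hm y).
have fin_between z : m%:E <= z <= (m + D)%:E ->
    exists2 u, z = u%:E & (m <= u <= m + D)%R.
  move=> hz; have zf := between_fin_num hz; exists (fine z); rewrite ?fineK//.
  by rewrite -!lee_fin fineK.
have [u -> hu] := fin_between _ (Hm x).
have [v -> hv] := fin_between _ Pim.
by exists u, v; split => //; rewrite ler_norml; apply/andP; split; lra.
Qed.

End kernel_integrals.

(** * Jensen's inequality for a nondecreasing concave function *)

(** The slope s is the right derivative of c at K, that is the supremum of the
    slopes of the chords to the right of K; concavity bounds these by the slopes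
    of the chords to the left, and monotonicity makes s nonnegative.  As K is
    an interior point, the chords to the left exist and the supremum is
    finite. *)
Lemma concave_supergradient (R : realType) (c : R -> R) (K : R) :
  0 < K -> {in `[0, +oo[ &, {homo c : u v / u <= v}} ->
  concave_function `[0, +oo[ c ->
  exists2 s, 0 <= s & forall u, 0 <= u -> c u <= c K + s * (u - K).
Proof.
move=> K0 cnd /concave_functionP cc.
have slope u w : 0 <= w -> w < K -> K < u ->
    (c u - c K) / (u - K) <= (c K - c w) / (K - w).
  move=> w0 wK Ku.
  rewrite ler_pdivrMr ?subr_gt0// mulrAC ler_pdivlMr ?subr_gt0//.
  have uw : 0 < u - w by lra.
  have l01 : 0 <= (K - w) / (u - w) <= 1.
    by rewrite divr_ge0 ?ler_pdivrMr//; lra.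
  (* K is the convex combination of u and w with weight (K - w) / (u - w)
     on u. *)
  have := cc _ l01 u w; rewrite /= !in_itv/= !andbT.
  move=> /(_ ltac:(lra) w0).
  have -> : (K - w) / (u - w) * u + (1 - (K - w) / (u - w)) * w = K.
    by field; lra.
  have -> : (K - w) / (u - w) * c u + (1 - (K - w) / (u - w)) * c w =
     ((K - w) * c u + (u - K) * c w) / (u - w) by field; lra.
  by rewrite ler_pdivrMr//; lra.
pose S := [set (c u - c K) / (u - K) | u in [set u | K < u]].
have S0 : S !=set0.
  by exists ((c (K + 1) - c K) / (K + 1 - K)); exists (K + 1) => //=; lra.
have Sub w : 0 <= w -> w < K -> ubound S ((c K - c w) / (K - w)).
  by move=> w0 wK _ [u /= Ku <-]; exact: slope.
have Sbd : has_ubound S by exists ((c K - c 0) / (K - 0)); apply: Sub.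
have le_supS u : K < u -> (c u - c K) / (u - K) <= sup S.
  by move=> Ku; apply: ub_le_sup => //; exists u.
exists (sup S).
  apply: le_trans (le_supS (K + 1) _); last lra.
  apply: divr_ge0; last lra.
  by rewrite subr_ge0; apply: cnd; rewrite ?in_itv/= ?andbT; lra.
move=> u u0; case: (ltgtP u K) => [uK|Ku|->]; last by lra.
  have : sup S <= (c K - c u) / (K - u) by apply: ge_sup => //; exact: Sub.
  by rewrite ler_pdivlMr ?subr_gt0//; lra.
by have := le_supS _ Ku; rewrite ler_pdivrMr ?subr_gt0//; lra.
Qed.

Section jensen.
Context d (X : measurableType d) (R : realType).

Lemma measurable_nondecreasing_comp (c : R -> R) (V : X -> R) :
  {in `[0, +oo[ &, {homo c : u v / u <= v}} ->
  measurable_fun [set: X] V -> (forall x, 0 <= V x) ->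
  measurable_fun [set: X] (c \o V).
Proof.
move=> cnd mV V0.
(* Freezing c at c 0 on the negative half-line makes it monotone on R. *)
have -> : c \o V = (fun u => c (Num.max u 0)) \o V.
  by apply/funext => x /=; rewrite max_l.
apply: measurableT_comp => //; apply: nondecreasing_measurable => // u v uv.
apply: cnd; rewrite ?in_itv/= ?andbT; last first.
- by rewrite ge_max !le_max uv lexx orbT.
- by rewrite le_max lexx orbT.
- by rewrite le_max lexx orbT.
Qed.

(** The supergradient inequality is integrated in the form
    c(V) <= (c(K) - s K) + s V, whose constant term is nonnegative because it
    bounds c(0) from above; every integrand is then nonnegative, and s >= 0
    lets the integral of V be replaced by its bound K. *)
Lemma le_integral_concave (mu : {measure set X -> \bar R}) (c : R -> R)
    (V : X -> R) (K : R) :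
  mu [set: X] = 1%E ->
  measurable_fun [set: X] V -> (forall x, 0 <= V x) ->
  0 < K -> (\int[mu]_y (V y)%:E <= K%:E)%E ->
  {in `[0, +oo[, forall u, 0 <= c u} ->
  {in `[0, +oo[ &, {homo c : u v / u <= v}} ->
  concave_function `[0, +oo[ c ->
  (\int[mu]_y (c (V y))%:E <= (c K)%:E)%E.
Proof.
move=> mu1 mV V0 K0 VK c0 cnd cc.
have [s s0 cs] := concave_supergradient K0 cnd cc.
have a0 : 0 <= c K - s * K.
  apply: le_trans (c0 0 _) _; first by rewrite in_itv/= lexx.
  by have := cs 0 (lexx _); lra.
apply: (@le_trans _ _ (\int[mu]_y ((c K - s * K)%:E + s%:E * (V y)%:E)))%E.
  apply: ge0_le_integral => //.
  - by move=> y _; rewrite lee_fin c0// in_itv/= V0.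
  - by apply/measurable_EFinP; exact: measurable_nondecreasing_comp.
  - apply/measurable_EFinP; apply: measurable_funD => //.
    exact: measurable_funM.
  - by move=> y _; rewrite -EFinM -EFinD lee_fin; have := cs _ (V0 y); lra.
rewrite ge0_integralD//; last 2 first.
- by move=> y _; rewrite -EFinM lee_fin mulr_ge0.
- by apply/measurable_EFinP; exact: measurable_funM.
rewrite integral_cst// mu1 mule1 ge0_integralZl_EFin//; last 2 first.
- by move=> y _; rewrite lee_fin.
- exact/measurable_EFinP.
apply: (@le_trans _ _ ((c K - s * K)%:E + s%:E * K%:E))%E.
  by rewrite leeD2l// lee_wpmul2l.
by rewrite -EFinM -EFinD lee_fin; lra.
Qed.

End jensen.

(** * Convergence to the invariant measure *)

Theorem theorem2p1 (R : realType) (d : measure_display) (X : measurableType d)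
    (P : R.-pker X ~> X) (Pi : probability X R) (V : X -> R)
    (hPi : unique_invariant P Pi)
    (mV : measurable_fun [set: X] V) (V0 : forall x, 0 <= V x)
    (K : R) (K0 : 0 < K)
    (hK : forall x, (\int[P x]_y (V y)%:E <= K%:E)%E)
    (r : R) (r1 : 1 < r) (nu : probability X R)
    (alpha : R) (alpha01 : 0 < alpha <= 1)
    (hminor : forall x, V x <= r * K ->
       forall B, measurable B -> (alpha%:E * nu B <= P x B)%E)
    (c : R -> R) (c0 : {in `[0, +oo[, forall u, 0 <= c u})
    (cnd : {in `[0, +oo[ &, {homo c : u v / u <= v}})
    (cconc : concave_function `[0, +oo[ c) :
  forall (x : X) (t : nat), (1 <= t)%N ->
    (tv_dist (kpow P (2 * t) x) Pi
       <= ((1 - alpha * (1 - 1 / r)) ^+ t)%:E)%E /\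
    (weighted_dist (c \o V) (kpow P (2 * t + 1) x) Pi
       <= (2 * c K * (1 - alpha * (1 - 1 / r)) ^+ t)%:E)%E.
Proof.
move=> x t _; have [invPi _] := hPi.
have /andP[a0 a1] := alpha01.
set b := alpha * (1 - 1 / r).
have b0 : 0 <= b.
  apply: mulr_ge0; first exact: ltW.
  by rewrite subr_ge0 div1r invf_le1 ?(lt_trans _ r1)// ltW.
have minor2 := minorization_kpow2 mV V0 K0 hK r1 (ltW a0) hminor.
have conv := doeblin_convergence invPi b0 minor2.
split; apply: ge_ereal_sup => _ [f [mf fb] <-].
  have f0 y : (0 <= (f y)%:E)%E by rewrite lee_fin; case/andP: (fb y).
  have fE y : (\int[kpow P 0 y]_z (f z)%:E <= 1%:E)%E.
    rewrite integral_kpow0; last exact/measurable_EFinP.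
    by rewrite lee_fin; case/andP: (fb y).
  have [|u [v []]] := conv 0%N 1 _ f0 _ fE t x; first exact/measurable_EFinP.
  rewrite addn0 => -> -> le_uv.
  by rewrite -EFinB abse_EFin lee_fin -[leRHS]mul1r.
have cV0 y : 0 <= c (V y) by apply: c0; rewrite in_itv/= V0.
have kpow1_bound (g : X -> \bar R) : (forall y, (0 <= g y)%E) ->
    measurable_fun [set: X] g -> (forall y, (g y <= (c (V y))%:E)%E) ->
    forall y, (\int[kpow P 1 y]_z g z <= (c K)%:E)%E.
  move=> g0 mg gc y; rewrite integral_kpow1.
  apply: (@le_trans _ _ (\int[P y]_z (c (V z))%:E)%E).
    apply: ge0_le_integral => //.
    by apply/measurable_EFinP; exact: measurable_nondecreasing_comp.
  by apply: le_integral_concave => //; exact: prob_kernel.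
have mfE : measurable_fun [set: X] (EFin \o f) by exact/measurable_EFinP.
have mp : measurable_fun [set: X] (EFin \o f)^\+%E by exact: measurable_funepos.
have mn : measurable_fun [set: X] (EFin \o f)^\-%E by exact: measurable_funeneg.
have fp y : ((EFin \o f)^\+ y <= (c (V y))%:E)%E.
  rewrite funeposE /= -EFin_max lee_fin ge_max cV0 andbT.
  exact: le_trans (ler_norm _) (fb y).
have fn y : ((EFin \o f)^\- y <= (c (V y))%:E)%E.
  rewrite funenegE /= -EFin_max lee_fin ge_max cV0 andbT.
  by apply: le_trans (fb y); rewrite -normrN ler_norm.
have [u [v [Eu Ev le_uv]]] :=
  conv 1%N (c K) _ (@funepos_ge0 _ _ _) mp
    (kpow1_bound _ (@funepos_ge0 _ _ _) mp fp) t x.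
have [u' [v' [Eu' Ev' le_uv']]] :=
  conv 1%N (c K) _ (@funeneg_ge0 _ _ _) mn
    (kpow1_bound _ (@funeneg_ge0 _ _ _) mn fn) t x.
rewrite integralE [X in (_ - X)%E]integralE Eu Eu' Ev Ev'.
rewrite -!EFinB abse_EFin lee_fin.
have -> : u - u' - (v - v') = (u - v) - (u' - v') by lra.
by apply: le_trans (ler_normB _ _) _; rewrite -mulrA mulr_natl mulr2n lerD.
Qed.
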